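(* $BR_8(K_{2,2},K_{4,4})=16$.
   Context: For bipartite graphs $H_1,H_2$ and a positive integer $m$, $BR_m(H_1,H_2)$ is the least positive integer $n$ such that for every subgraph $G$ of $K_{m,n}$ (parts of sizes $m$ and $n$), either $G$ contains a copy of $H_1$ or the bipartite complement $\overline{G}=K_{m,n}-E(G)$ contains a copy of $H_2$. *)

(* Defs.v *)
From mathcomp Require Import all_boot.

Set Implicit Arguments.
Unset Strict Implicit.
Unset Printing Implicit Defensive.

Record graph (V : finType) := Graph {
  edge : rel V;
  edge_sym : symmetric edge;
  edge_irr : irreflexive edge
}.

(* G and H share the vertex set V, so only edge sets are compared. *)
Definition subgraph (V : finType) (G H : graph V) : Prop :=
  subrel (edge G) (edge H).

Section GraphDiff.

Variables (V : finType) (H G : graph V).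

Definition diff_edge : rel V := [rel x y | edge H x y && ~~ edge G x y].

Lemma diff_edge_sym : symmetric diff_edge.
Proof. by move=> x y; rewrite /diff_edge /= edge_sym (edge_sym G). Qed.

Lemma diff_edge_irr : irreflexive diff_edge.
Proof. by move=> x; rewrite /diff_edge /= edge_irr. Qed.

(* H - E(G) *)
Definition graph_diff : graph V := Graph diff_edge_sym diff_edge_irr.

End GraphDiff.

(* A copy of H in G: a subgraph, not necessarily induced, isomorphic to H. *)
Definition contains_copy (U V : finType) (G : graph V) (H : graph U) : Prop :=
  exists2 f : U -> V, injective f & forall x y, edge H x y -> edge G (f x) (f y).

Definition bipartite (V : finType) (G : graph V) : Prop :=
  exists A : {set V}, forall x y, edge G x y -> (x \in A) != (y \in A).

Section CompleteBipartite.

Variables m n : nat.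

Definition Kmn_edge : rel ('I_m + 'I_n)%type :=
  fun x y => match x, y with
             | inl _, inr _ | inr _, inl _ => true
             | _, _ => false
             end.

Lemma Kmn_edge_sym : symmetric Kmn_edge.
Proof. by move=> [i|i] [j|j]. Qed.

Lemma Kmn_edge_irr : irreflexive Kmn_edge.
Proof. by move=> [i|i]. Qed.

Definition Kmn : graph ('I_m + 'I_n)%type := Graph Kmn_edge_sym Kmn_edge_irr.

End CompleteBipartite.

Lemma Kmn_bipartite (m n : nat) : bipartite (Kmn m n).
Proof.
exists [set x : 'I_m + 'I_n | if x is inl _ then true else false].
by move=> [i|i] [j|j] //= _; rewrite !inE.
Qed.

Definition BR_arrows (m n : nat) (U1 U2 : finType)
    (H1 : graph U1) (H2 : graph U2) : Prop :=
  forall G : graph ('I_m + 'I_n)%type, subgraph G (Kmn m n) ->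
    contains_copy G H1 \/ contains_copy (graph_diff (Kmn m n) G) H2.

(* BR_m(H1, H2) = n. A relation, since for small m no n may have the property.
   The number is defined for bipartite H1 and H2, whence the two conjuncts. *)
Definition is_BR (m : nat) (U1 U2 : finType)
    (H1 : graph U1) (H2 : graph U2) (n : nat) : Prop :=
  [/\ bipartite H1, bipartite H2, 0 < n, BR_arrows m n H1 H2
    & forall k : nat, 0 < k -> BR_arrows m k H1 H2 -> n <= k].

(* Main.v *)
Require Import Defs.
From mathcomp Require Import all_boot.
From mathcomp Require Import zify.

Set Implicit Arguments.
Unset Strict Implicit.
Unset Printing Implicit Defensive.

(** Read each of the n columns as a block: its set of neighbours among the 8
    rows.  K_{2,2}-freeness says that two blocks share at most one row, and
    K_{4,4}-freeness of the complement says that a 4-set of rows contains at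
    most 3 blocks.  The second condition alone, by averaging over the deletion
    of one row, bounds the number of 2-element blocks inside 5, 6, 7, 8 rows by
    5, 6, 8, 10 (6 rows need a separate argument).  With 16 blocks, counting
    the 56 ordered pairs of rows then forces 10 blocks of size 2 and 6 of size
    at least 3; every row lies in at least 10 - 8 = 2 of the former, hence in at
    most 2 of the latter, so that 6 * 3 <= 8 * 2. *)

(** * Finite sets: subsets of prescribed size and a union bound *)

Lemma subset_card_between (T : finType) (D E : {set T}) (k : nat) :
    D \subset E -> #|D| <= k <= #|E| ->
  exists S : {set T}, [/\ D \subset S, S \subset E & #|S| = k].
Proof.
move=> DE; elim: k => [|k IH] /andP[Dk kE].
  by exists D; split=> //; apply/eqP; rewrite -leqn0.
have [Dk1|Dk1] := leqP #|D| k; last by exists D; split=> //; lia.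
have [|S [DS SE Sk]] := IH; first by rewrite Dk1 ltnW.
have: 0 < #|E :\: S| by rewrite cardsD (setIidPr SE) Sk subn_gt0.
case/card_gt0P=> x; rewrite inE => /andP[xS xE].
exists (x |: S); split; last by rewrite cardsU1 xS Sk.
  exact: subset_trans DS (subsetUr _ _).
by rewrite subUset sub1set xE.
Qed.

Lemma leq_card_bigcup (I J : finType) (A : {set J}) (F : J -> {set I})
    (X : {set I}) (c : nat) :
    X \subset \bigcup_(j in A) F j -> (forall j, j \in A -> #|F j| <= c) ->
  #|X| <= #|A| * c.
Proof.
move=> sXF Fc; apply: leq_trans (subset_leq_card sXF) _.
rewrite -sum_nat_const; apply: leq_trans _ (leq_sum _ Fc).
elim/big_rec2: _ => [|j m U _ mU]; first by rewrite cards0.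
by apply: leq_trans (leq_card_setU _ _) _; rewrite leq_add2l.
Qed.

(** * Two-element blocks inside small sets of rows *)

Section BlockFamily.

Variables (I T : finType) (B : I -> {set T}).

Definition blocks_in (S : {set T}) : {set I} := [set i | B i \subset S].

Definition pairs_in (S : {set T}) : {set I} :=
  [set i | (#|B i| == 2) && (B i \subset S)].

(** Double counting: a pair inside [S] survives the deletion of [v] exactly when [v] is one of the
    [#|S| - 2] points of [S] outside it. *)
Lemma sum_pairs_inD1 (S : {set T}) :
  \sum_(v in S) #|pairs_in (S :\ v)| = #|pairs_in S| * (#|S| - 2).
Proof.
under eq_bigr do rewrite -sum1_card.
rewrite (exchange_big_dep (mem (pairs_in S))) /=; last first.
  move=> v i _; rewrite !inE => /andP[-> /subset_trans-> //].
  exact: subD1set.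
rewrite -sum_nat_const; apply: eq_bigr => i; rewrite inE => /andP[/eqP i2 iS].
rewrite sum1dep_card.
have -> : #|S| - 2 = #|S :\: B i| by rewrite cardsD (setIidPr iS) i2.
apply: eq_card => v; rewrite !inE subsetD1 iS i2 /=.
by rewrite andbC.
Qed.

Lemma pairs_in_step (k b : nat) (S : {set T}) :
    (forall R : {set T}, #|R| = k -> #|pairs_in R| <= b) -> #|S| = k.+1 ->
  #|pairs_in S| * k.-1 <= k.+1 * b.
Proof.
move=> kb Sk; have -> : k.-1 = #|S| - 2 by rewrite Sk; lia.
rewrite -sum_pairs_inD1 -[X in _ <= X * _]Sk -sum_nat_const.
by apply: leq_sum => v vS; apply: kb; have := cardsD1 v S; rewrite vS; lia.
Qed.

Lemma pairs_inS (C S : {set T}) : C \subset S -> pairs_in C \subset pairs_in S.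
Proof.
move=> CS; apply/subsetP => i; rewrite !inE => /andP[-> /subset_trans-> //].
Qed.

(** A pair inside neither [C] nor [R] joins some [x] in [R] to a point of [C], so it is one of the
    at most [c - #|pairs_in C|] pairs that [x |: C] adds to those of [C]. *)
Lemma card_pairs_inU (C R : {set T}) (c : nat) :
    (forall x, x \in R -> #|pairs_in (x |: C)| <= c) ->
  #|pairs_in (C :|: R)| <=
    #|pairs_in C| + #|pairs_in R| + #|R| * (c - #|pairs_in C|).
Proof.
move=> hc.
set X := pairs_in (C :|: R) :\: (pairs_in C :|: pairs_in R).
have hX : X \subset \bigcup_(x in R) (pairs_in (x |: C) :\: pairs_in C).
  apply/subsetP => i; rewrite !inE negb_or.
  case/andP=> /andP[iC iR] /andP[/[dup] i2 /cards2P[x [y [xy Bi]]] iCR].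
  move: iC iR iCR; rewrite i2 Bi /= !subUset !sub1set !inE.
  move=> iC iR /andP[xCR yCR].
  have [z zR zC] : exists2 z, z \in R & [set x; y] \subset z |: C.
    case: (boolP (x \in R)) xCR iR => [xR _ | xR]; last first.
      rewrite orbF => xC _; exists y; first by move: yCR iC; rewrite xC /= => /orP[->|].
      by rewrite subUset !sub1set !inE xC eqxx orbT.
    move=> /= yR; exists x => //.
    by rewrite subUset !sub1set !inE eqxx; move: yCR; rewrite (negPf yR) orbF => ->; rewrite orbT.
  by apply/bigcupP; exists z; rewrite // !inE Bi -Bi i2 /= Bi zC subUset !sub1set iC.
have /leq_card_bigcup -/(_ (c - #|pairs_in C|)) hXc := hX.
have /(leq_add (leq_card_setU (pairs_in C) (pairs_in R))) : #|X| <= #|R| * (c - #|pairs_in C|).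
  apply: hXc => x xR; rewrite cardsD.
  have /setIidPr-> := pairs_inS (subsetUr [set x] C).
  exact: leq_sub2r (hc x xR).
apply: leq_trans; rewrite addnC -(cardsID (pairs_in C :|: pairs_in R)) addnC leq_add2l.
by apply: subset_leq_card; exact: subsetIr.
Qed.

Hypothesis cardT : 4 <= #|T|.
Hypothesis blocks_in4 : forall S : {set T}, #|S| = 4 -> #|blocks_in S| <= 3.

Lemma pairs_in_blocks (S : {set T}) : pairs_in S \subset blocks_in S.
Proof. by apply/subsetP=> i; rewrite !inE => /andP[]. Qed.

Lemma pairs_in4 (S : {set T}) : #|S| <= 4 -> #|pairs_in S| <= 3.
Proof.
move=> S4; have [||R [SR _ R4]] := @subset_card_between T S setT 4.
- exact: subsetT.
- by rewrite S4 cardsT.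
apply: leq_trans (blocks_in4 R4); apply: subset_leq_card.
exact: subset_trans (pairs_inS SR) (pairs_in_blocks R).
Qed.

Lemma pairs_in5 (S : {set T}) : #|S| = 5 -> #|pairs_in S| <= 5.
Proof.
move/(@pairs_in_step 4 3 S) => h.
have : #|pairs_in S| * 3 <= 15 by apply: h => R R4; apply: pairs_in4; rewrite R4.
lia.
Qed.

(* Averaging only gives 7.  If 7 were attained, some v would lie in exactly two
   pairs of S; split S into a 3-set C containing both of them and its complement,
   and count the pairs crossing the split from either side. *)
Lemma pairs_in6 (S : {set T}) : #|S| = 6 -> #|pairs_in S| <= 6.
Proof.
move=> S6; rewrite leqNgt; apply/negP => e7.
have e7' : #|pairs_in S| = 7 by have := pairs_in_step pairs_in5 S6; lia.
(* By [sum_pairs_inD1] the six deletion counts sum to 7 * 4 = 28, so one is at least 5. By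
   [pairs_in5] it is exactly 5, which leaves 7 - 5 = 2 pairs through [v]. *)
have [v vS ev] : exists2 v, v \in S & 5 <= #|pairs_in (S :\ v)|.
  apply/exists_inP; apply: contraT; rewrite negb_exists_in => /forall_inP lt5.
  have : \sum_(v in S) #|pairs_in (S :\ v)| <= \sum_(v in S) 4.
    by apply: leq_sum => v /lt5; rewrite -ltnNge.
  by rewrite sum_pairs_inD1 sum_nat_const e7' S6.
have Sv5 : #|S :\ v| = 5 by have := cardsD1 v S; rewrite vS S6; lia.
have := pairs_in5 Sv5 => ev'.
have evE : #|pairs_in (S :\ v)| = 5 by lia.
have : #|pairs_in S :\: pairs_in (S :\ v)| == 2.
  by rewrite cardsD (setIidPr (pairs_inS (subD1set S v))) e7' evE.
case/cards2P=> i [j [ij Dij]].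
have hD k : k \in [set i; j] -> [/\ #|B k| = 2, B k \subset S & v \in B k].
  rewrite -Dij !inE => /andP[+ /andP[/eqP k2 kS]].
  by rewrite k2 kS subsetD1 kS /= negbK => ->.
have [[i2 iS vi] [j2 jS vj]] := (hD i (set21 i j), hD j (set22 i j)).
have [||C [ijC CS C3]] := @subset_card_between T (B i :|: B j) S 3.
- by rewrite subUset iS.
- rewrite S6 cardsU i2 j2 andbT.
  have : 0 < #|B i :&: B j| by apply/card_gt0P; exists v; rewrite inE vi.
  lia.
have [iC jC] : B i \subset C /\ B j \subset C by apply/andP; rewrite -subUset.
have vC : v \in C by apply: (subsetP iC).
have eC : #|pairs_in (C :\ v)| + 2 <= #|pairs_in C|.
  have /setIidPr eCv := pairs_inS (subD1set C v).
  rewrite -(cardsID (pairs_in (C :\ v)) (pairs_in C)) eCv leq_add2l.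
  apply: leq_trans (subset_leq_card (_ : [set i; j] \subset _)); first by rewrite cards2 ij.
  by rewrite subUset !sub1set !inE i2 j2 iC jC !subsetD1 vi vj !andbF.
have R3 : #|S :\: C| = 3 by rewrite cardsD (setIidPr CS) S6 C3.
have Cv2 : #|C :\ v| = 2 by have := cardsD1 v C; rewrite vC; lia.
have eC3 : #|pairs_in C| <= 3 by rewrite pairs_in4 ?C3.
have eR3 : #|pairs_in (S :\: C)| <= 3 by rewrite pairs_in4 ?R3.
have /(_ 3) := @card_pairs_inU C (S :\: C).
have -> : C :|: S :\: C = S by rewrite -{1}(setIidPr CS) setID.
rewrite R3 e7' => hU1.
have {}hU1 := hU1 _; have /(_ 3) := @card_pairs_inU (S :\: C) (C :\ v).
have -> : S :\: C :|: C :\ v = S :\ v.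
  apply/setP=> x; rewrite !inE; have := subsetP CS x.
  by case: (eqVneq x v) => [->|_]; [rewrite vC | case: (x \in C) => [->|_] //; rewrite orbF].
rewrite Cv2 evE => hU2.
have {}hU1 : 7 <= #|pairs_in C| + #|pairs_in (S :\: C)| + 3 * (3 - #|pairs_in C|).
  by apply: hU1 => x _; rewrite pairs_in4 // cardsU1 C3; case: (_ \notin _).
have {}hU2 : 5 <= #|pairs_in (S :\: C)| + #|pairs_in (C :\ v)|
                  + 2 * (3 - #|pairs_in (S :\: C)|).
  by apply: hU2 => x _; rewrite pairs_in4 // cardsU1 R3; case: (_ \notin _).
(* Let c, r, p count the pairs in [C], [S :\: C], [C :\ v]. Then [hU1] gives 2c <= r + 2 <= 5, and
   with p + 2 <= c this forces c = 2, p = 0 and r >= 2; but [hU2] gives r <= p + 1 = 1. *)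
lia.
Qed.

Lemma pairs_in7 (S : {set T}) : #|S| = 7 -> #|pairs_in S| <= 8.
Proof. by move/(pairs_in_step pairs_in6) => /=; lia. Qed.

Lemma pairs_in8 (S : {set T}) : #|S| = 8 -> #|pairs_in S| <= 10.
Proof. by move/(pairs_in_step pairs_in7) => /=; lia. Qed.

(** * Blocks of size at most 2 among eight rows *)

Definition blocks_le (n : nat) : {set I} := [set i | #|B i| <= n].

Hypothesis card8 : #|T| = 8.

(* As long as a block of size at most 2 outside A touches D, absorbing it
   enlarges A by one block and D by at most one point; at |D| = 4 this
   contradicts [blocks_in4].  When nothing outside A touches D, the remaining
   pairs live on 8 - k points. *)
Lemma blocks_le2_absorb (k : nat) (A : {set I}) (D : {set T}) :
    blocks_le 1 \subset A -> A \subset blocks_le 2 -> A \subset blocks_in D ->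
    #|A| = k -> #|D| = k -> k <= 4 ->
  #|blocks_le 2| <= maxn 8 (10 - k).
Proof.
move=> sA; move m: (4 - k) => n.
elim: n k m A D sA => [|n IH] k m A D sA A2 AD Ak Dk k4.
  have Dk4 : #|D| = 4 by lia.
  by have := subset_leq_card AD; have := blocks_in4 Dk4; lia.
have [/exists_inP[i] | no] :=
    boolP [exists i in blocks_le 2 :\: A, B i :&: D != set0].
  rewrite !inE => /andP[iA i2] /set0Pn[x xBD].
  have [||D' [sD' _ D'k]] := @subset_card_between T (D :|: B i) setT k.+1.
  - exact: subsetT.
  - rewrite cardsT card8 cardsU Dk setIC.
    have : 0 < #|B i :&: D| by apply/card_gt0P; exists x.
    by move: i2; lia.
  apply: leq_trans (_ : maxn 8 (10 - k.+1) <= _); last by lia.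
  apply: (IH k.+1 _ (i |: A) D'); rewrite ?subUset ?sub1set ?inE ?i2 //; try lia.
  - exact: subset_trans sA (subsetUr _ _).
  - move: sD'; rewrite subUset => /andP[DD' ->] /=.
    apply: subset_trans AD _; apply/subsetP=> j; rewrite !inE => jD.
    exact: subset_trans jD DD'.
  - by rewrite cardsU1 iA Ak.
(* A block of [blocks_le 2] outside [A] has size exactly 2, since [A] contains all smaller ones, and
   it avoids [D]. *)
have sub : blocks_le 2 \subset A :|: pairs_in (~: D).
  apply/subsetP=> i i2; rewrite inE; case: (boolP (i \in A)) => //= iA.
  move: no; rewrite negb_exists_in => /forall_inP/(_ i).
  rewrite inE iA i2 => /(_ isT); rewrite negbK => /eqP BiD.
  rewrite inE -disjoints_subset -setI_eq0 BiD eqxx andbT eqn_leq.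
  move: i2; rewrite inE => -> /=.
  by move: (contra (subsetP sA i) iA); rewrite inE -ltnNge.
have := leq_trans (subset_leq_card sub) (leq_card_setU _ _).
have : #|~: D| = 8 - k by rewrite cardsCs setCK card8 Dk.
(* For k = 0, 1, 2, 3 the totals are 0 + 10, 1 + 8, 2 + 6, 3 + 5, which is where [maxn 8 (10 - k)]
   comes from. *)
case: k k4 m Ak {IH Dk} => [|[|[|[|k]]]] // _ _ Ak Dk; rewrite Ak.
- by have := pairs_in8 Dk; lia.
- by have := pairs_in7 Dk; lia.
- by have := pairs_in6 Dk; lia.
- by have := pairs_in5 Dk; lia.
Qed.

Lemma blocks_le1_cover (A : {set I}) :
  A \subset blocks_le 1 -> #|\bigcup_(i in A) B i| <= #|A|.
Proof.
move=> A1; rewrite -[leqRHS]muln1; apply: leq_card_bigcup (subxx _) _ => i iA.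
by have := subsetP A1 i iA; rewrite inE.
Qed.

(** Four blocks of size at most 1 would all fit into a single 4-set, against [blocks_in4]. *)
Lemma card_blocks_le1 : #|blocks_le 1| <= 3.
Proof.
rewrite leqNgt; apply/negP => s4.
have [||A [_ A1 A4]] := @subset_card_between I set0 (blocks_le 1) 4.
- exact: sub0set.
- by rewrite cards0.
have [||D [sD _ D4]] := @subset_card_between T (\bigcup_(i in A) B i) setT 4.
- exact: subsetT.
- by have := blocks_le1_cover A1; rewrite A4 cardsT card8 => ->.
have : A \subset blocks_in D.
  by apply/subsetP=> i iA; rewrite inE (subset_trans _ sD) // bigcup_sup.
by move/subset_leq_card; rewrite A4 leqNgt ltnS blocks_in4.
Qed.

(** The absorption starts from [A = blocks_le 1], with [D] a set of equally many points covering
    those blocks. *)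
Lemma card_blocks_le2 : #|blocks_le 2| <= maxn 8 (10 - #|blocks_le 1|).
Proof.
have s3 := card_blocks_le1.
have [||D [sD _ Ds]] := @subset_card_between T
    (\bigcup_(i in blocks_le 1) B i) setT #|blocks_le 1|.
- exact: subsetT.
- by rewrite blocks_le1_cover //= cardsT card8; lia.
apply: (@blocks_le2_absorb _ (blocks_le 1) D) => //; last by lia.
- by apply/subsetP=> i; rewrite !inE => /leq_trans->.
- by apply/subsetP=> i iA; rewrite inE (subset_trans _ sD) // bigcup_sup.
Qed.

(** * Linear families: counting ordered pairs of rows *)

Hypothesis linear_blocks : forall i j, i != j -> #|B i :&: B j| <= 1.

(** Two blocks through [v] share no further row, so the sets [B i :\ v] are disjoint inside the 7
    other rows. *)
Lemma sum_card_block_pred (v : T) : \sum_(i | v \in B i) (#|B i| - 1) <= 7.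
Proof.
have -> : 7 = \sum_(y in ~: [set v]) 1 by rewrite sum1_card cardsC1 card8.
have E i : v \in B i -> #|B i| - 1 = \sum_(y in B i :\ v) 1.
  by move=> vi; rewrite sum1_card (cardsD1 v (B i)) vi; lia.
rewrite (eq_bigr _ E) (exchange_big_dep (mem (~: [set v]))) /=; last first.
  by move=> i y _; rewrite !inE => /andP[].
apply: leq_sum => y; rewrite !inE => yv; rewrite sum1dep_card.
rewrite leqNgt; apply/negP=> /card_gt1P[i [j []]].
rewrite !inE yv /= => /andP[vi yi] /andP[vj yj] ij.
have := linear_blocks ij; rewrite leqNgt => /negP; apply.
by apply/card_gt1P; exists v, y; split; rewrite ?inE ?vi ?yi // eq_sym.
Qed.

Lemma sum_card_block_mul : \sum_i #|B i| * (#|B i| - 1) <= 56.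
Proof.
have -> : 56 = \sum_(v : T) 7 by rewrite sum_nat_const card8.
apply: leq_trans (leq_sum _ (fun v _ => sum_card_block_pred v)).
rewrite (exchange_big_dep predT) //=; apply: eq_leq; apply: eq_bigr => i _.
by rewrite sum_nat_const.
Qed.

Lemma card_linear_blocks : #|I| < 16.
Proof.
rewrite ltnNge; apply/negP=> I16.
have s3 := card_blocks_le1; have N := card_blocks_le2.
have [s0 N10] : #|blocks_le 1| = 0 /\ #|blocks_le 2| = 10.
  (* The correction terms raise every summand to at least 6 = 3 * 2, the value at block size 3.
     Hence 4 * N2 + 2 * N1 >= 96 - 56 = 40 for the counts N1, N2 of [blocks_le 1], [blocks_le 2];
     with N1 <= 3 and N2 <= max(8, 10 - N1), only N1 = 0, N2 = 10 remains. *)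
  have : 96 <= \sum_i (#|B i| * (#|B i| - 1)
      + (4 * (#|B i| <= 2) + 2 * (#|B i| <= 1))).
    apply: (@leq_trans (#|I| * 6)); first by lia.
    by rewrite -sum_nat_const; apply: leq_sum => i _; case: #|B i| => [|[|[|n]]] //; nia.
  rewrite 2!big_split /= -!big_distrr /=.
  rewrite -[\sum_i (_ <= 2)]big_mkcond -[\sum_i (_ <= 1)]big_mkcond.
  have := sum_card_block_mul; rewrite !sum1dep_card.
  rewrite -/(blocks_le 2) -/(blocks_le 1).
  lia.
have noS i : 1 < #|B i|.
  by rewrite ltnNge; apply/negP=> i1; have := card0_eq s0 i; rewrite !inE i1.
have eT : pairs_in setT = blocks_le 2.
  by apply/setP=> i; rewrite !inE subsetT andbT eqn_leq noS andbT.
(* At most 8 of the 10 pairs avoid [v], so at least 2 contain it. Each uses one of the 7 other rows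
   and each larger block uses at least two, so x larger blocks satisfy 2 + 2x <= 7. *)
have big2 v : #|[set i | (2 < #|B i|) && (v \in B i)]| <= 2.
  have e7 : #|pairs_in (setT :\ v)| <= 8.
    by apply: pairs_in7; have := cardsD1 v setT; rewrite inE cardsT card8; lia.
  have p2 : 2 <= #|[set i | (#|B i| == 2) && (v \in B i)]|.
    have := cardsID (pairs_in (setT :\ v)) (pairs_in setT).
    rewrite (setIidPr (pairs_inS (subsetT _))) eT N10 -eT.
    have -> : pairs_in setT :\: pairs_in (setT :\ v)
            = [set i | (#|B i| == 2) && (v \in B i)].
      by apply/setP=> i; rewrite !inE subsetD1 subsetT /=; case: (#|B i| == 2); rewrite /= ?negbK ?andbT.
    lia.
  have := sum_card_block_pred v.
  have : \sum_(i | v \in B i) ((#|B i| == 2) + 2 * (2 < #|B i|))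
      <= \sum_(i | v \in B i) (#|B i| - 1).
    by apply: leq_sum => i _; case: #|B i| => [|[|[|n]]].
  rewrite big_split /= -big_distrr /= -!big_mkcondr !sum1dep_card.
  have -> : [set i | (v \in B i) && (#|B i| == 2)]
    = [set i | (#|B i| == 2) && (v \in B i)] by apply/setP=> i; rewrite !inE andbC.
  have -> : [set i | (v \in B i) && (2 < #|B i|)]
    = [set i | (2 < #|B i|) && (v \in B i)] by apply/setP=> i; rewrite !inE andbC.
  lia.
have : \sum_(v : T) #|[set i | (2 < #|B i|) && (v \in B i)]| <= \sum_(v : T) 2.
  exact: leq_sum.
rewrite sum_nat_const card8.
under eq_bigr do rewrite -sum1dep_card.
rewrite (exchange_big_dep (mem (~: blocks_le 2))) /=; last first.
  by move=> v i _ /andP[]; rewrite !inE -ltnNge.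
have : \sum_(i in ~: blocks_le 2) 3 <=
   \sum_(i in ~: blocks_le 2) \sum_(v | (2 < #|B i|) && (v \in B i)) 1.
  apply: leq_sum => i; rewrite !inE -ltnNge => i3; rewrite sum1dep_card i3.
  by apply: leq_trans i3 (subset_leq_card _); apply/subsetP=> v; rewrite inE.
rewrite sum_nat_const cardsCs setCK N10; lia.
Qed.

End BlockFamily.

(** * Translation between block families and graphs *)

Lemma inj_ord_in (T : finType) (A : {set T}) (k : nat) :
  k <= #|A| -> exists2 r : 'I_k -> T, injective r & forall i, r i \in A.
Proof.
move=> kA; exists (fun i => enum_val (widen_ord kA i)) => [i j|i].
  by move/enum_val_inj/(congr1 val) => /= /val_inj.
exact: enum_valP.
Qed.

Lemma Kmn_copy (m n a b : nat) (G : graph ('I_m + 'I_n)%type)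
    (r : 'I_a -> 'I_m) (c : 'I_b -> 'I_n) :
    injective r -> injective c ->
    (forall i j, edge G (inl (r i)) (inr (c j))) ->
  contains_copy G (Kmn a b).
Proof.
move=> rI cI rc.
exists (fun z => match z with inl i => inl (r i) | inr j => inr (c j) end).
  by move=> [i|i] [j|j] // [] => [/rI|/cI] ->.
by move=> [i|i] [j|j] //= _; rewrite // edge_sym.
Qed.

(* A complete bipartite graph is connected, so a copy of it inside a bipartite
   graph respects the two parts up to exchanging them. *)
Lemma Kmn_copy_inv (m n a : nat) (G : graph ('I_m + 'I_n)%type) :
    subgraph G (Kmn m n) -> contains_copy G (Kmn a.+1 a.+1) ->
  exists (r : 'I_a.+1 -> 'I_m) (c : 'I_a.+1 -> 'I_n),
    [/\ injective r, injective c & forall i j, edge G (inl (r i)) (inr (c j))].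
Proof.
move=> GK [f fI fE].
have fG i j : edge G (f (inl i)) (f (inr j)) by apply: fE.
have fK i j := GK _ _ (fG i j).
case f0: (f (inl ord0)) => [x|x].
  have [c cE] : exists c, forall j, f (inr j) = inr (c j).
    apply: (fin_all_exists (P := fun j y => f (inr j) = inr y)) => j.
    by have := fK ord0 j; rewrite f0 /=; case: (f _) => // y _; exists y.
  have [r rE] : exists r, forall i, f (inl i) = inl (r i).
    apply: (fin_all_exists (P := fun i y => f (inl i) = inl y)) => i.
    by have := fK i ord0; rewrite cE /=; case: (f _) => // y _; exists y.
  exists r, c; split=> [i j rij|i j cij|i j]; last by rewrite -rE -cE.
    by have [] : inl i = inl j :> 'I_a.+1 + 'I_a.+1 by apply: fI; rewrite !rE rij.
  by have [] : inr i = inr j :> 'I_a.+1 + 'I_a.+1 by apply: fI; rewrite !cE cij.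
have [r rE] : exists r, forall j, f (inr j) = inl (r j).
  apply: (fin_all_exists (P := fun j y => f (inr j) = inl y)) => j.
  by have := fK ord0 j; rewrite f0 /=; case: (f _) => // y _; exists y.
have [c cE] : exists c, forall i, f (inl i) = inr (c i).
  apply: (fin_all_exists (P := fun i y => f (inl i) = inr y)) => i.
  by have := fK i ord0; rewrite rE /=; case: (f _) => // y _; exists y.
exists r, c; split=> [i j rij|i j cij|i j]; last by rewrite edge_sym -rE -cE.
  by have [] : inr i = inr j :> 'I_a.+1 + 'I_a.+1 by apply: fI; rewrite !rE rij.
by have [] : inl i = inl j :> 'I_a.+1 + 'I_a.+1 by apply: fI; rewrite !cE cij.
Qed.

(** Two columns with two common rows give a [Kmn 2 2] in [G]; four blocks inside a 4-set [S] give a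
    [Kmn 4 4] in the complement, on the four rows outside [S]. If neither occurs,
    [card_linear_blocks] applies. *)
Lemma BR_arrows_8_16 : BR_arrows 8 16 (Kmn 2 2) (Kmn 4 4).
Proof.
move=> G GK; pose B (j : 'I_16) := [set x : 'I_8 | edge G (inl x) (inr j)].
case: (boolP [exists i, exists j, (i != j) && (1 < #|B i :&: B j|)]).
  case/existsP=> i /existsP[j /andP[ij /inj_ord_in[r rI rB]]]; left.
  have [|c cI cij] := @inj_ord_in _ [set i; j] 2; first by rewrite cards2 ij.
  apply: (Kmn_copy rI cI) => a b; have := rB a; rewrite !inE => /andP[ri rj].
  by have := cij b; rewrite !inE => /orP[]/eqP->.
rewrite negb_exists => /forallP/= nlin.
case: (boolP [exists S : {set 'I_8}, (#|S| == 4) && (3 < #|blocks_in B S|)]).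
  case/existsP=> S /andP[/eqP S4 /inj_ord_in[c cI cS]]; right.
  have [|r rI rS] := @inj_ord_in _ (~: S) 4; first by rewrite cardsCs setCK S4 card_ord.
  apply: (Kmn_copy rI cI) => i j /=.
  have := rS i; rewrite inE; apply: contra => e.
  by have := cS j; rewrite inE => /subsetP; apply; rewrite inE.
rewrite negb_exists => /forallP/= n4; exfalso.
suff : #|'I_16| < 16 by rewrite card_ord.
apply: (@card_linear_blocks _ _ B) => [|S S4||i j ij]; rewrite ?card_ord //.
  by have := n4 S; rewrite S4 /= -leqNgt.
by have := nlin i; rewrite negb_exists => /forallP/(_ j); rewrite ij /= -leqNgt.
Qed.

(** * Lower bound: a graph on 8 rows and 15 columns *)

(* Found by computer search; [nbr15 j] lists the neighbours of column j. *)
Definition nbr15 (j : nat) : seq nat := nth [::]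
  [:: [:: 0; 1]; [:: 0; 3; 4]; [:: 0; 6]; [:: 1; 2; 3]; [:: 1; 4];
      [:: 1; 5; 6]; [:: 1; 7]; [:: 2; 4]; [:: 2; 5; 7]; [:: 2; 6];
      [:: 3; 5]; [:: 3; 6]; [:: 3; 7]; [:: 4; 5]; [:: 4; 6; 7]] j.

(** The number [n] of columns stays free, so that taking the first [n] columns refutes every
    [n <= 15] directly. *)
Definition edge15 (n : nat) : rel ('I_8 + 'I_n)%type := fun x y =>
  match x, y with
  | inl i, inr j | inr j, inl i => val i \in nbr15 j
  | _, _ => false
  end.

Lemma edge15_sym (n : nat) : symmetric (@edge15 n).
Proof. by move=> [i|i] [j|j]. Qed.

Lemma edge15_irr (n : nat) : irreflexive (@edge15 n).
Proof. by move=> [i|i]. Qed.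

Definition graph15 (n : nat) := Graph (@edge15_sym n) (@edge15_irr n).

Lemma nbr15_linear : all (fun c => all (fun d => (c == d) ||
  (count (mem (nbr15 c)) (nbr15 d) <= 1)) (iota 0 15)) (iota 0 15).
Proof. by vm_compute. Qed.

(** Boolean form of [Kmn 4 4]-freeness of the complement, small enough to evaluate. *)
Lemma nbr15_avoid4 : all (fun w => all (fun x => all (fun y => all (fun z =>
  uniq [:: w; x; y; z] ==>
  (count (fun j => ~~ has (mem (nbr15 j)) [:: w; x; y; z]) (iota 0 15) <= 3))
  (iota 0 8)) (iota 0 8)) (iota 0 8)) (iota 0 8).
Proof. by vm_compute. Qed.

Lemma graph15_K22_free (n : nat) : n <= 15 -> ~ contains_copy (graph15 n) (Kmn 2 2).
Proof.
move=> n15 /Kmn_copy_inv[|r [c [rI cI rc]]]; first by move=> [i|i] [j|j].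
have lt15 j : val (c j) \in iota 0 15 by rewrite mem_iota (leq_trans (ltn_ord _)).
have /allP/(_ _ (lt15 ord0))/allP/(_ _ (lt15 ord_max)) := nbr15_linear.
case/orP=> [/eqP/val_inj/cI//|]; rewrite leqNgt => /negP; apply.
rewrite -size_filter.
(* Both rows of the copy are common neighbours of its two columns, so the count bounded by 1 would
   be at least 2. *)
apply: (@uniq_leq_size _ [:: val (r ord0); val (r ord_max)]).
  by rewrite /= inE andbT; apply/eqP=> /val_inj/rI.
have e i j : val (r i) \in nbr15 (val (c j)) by exact: rc.
by move=> x; rewrite mem_filter !inE => /orP[]/eqP->; apply/andP; split; exact: e.
Qed.

Lemma graph15_K44_free (n : nat) :
  n <= 15 -> ~ contains_copy (graph_diff (Kmn 8 n) (graph15 n)) (Kmn 4 4).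
Proof.
move=> n15 /Kmn_copy_inv[|r [c [rI cI rc]]]; first by move=> x y /andP[].
have lt8 i : val (r i) \in iota 0 8 by rewrite mem_iota ltn_ord.
(* Indexing ['I_4] by numbers presents the four rows as a map over [iota 0 4], so that distinctness
   and membership are handled uniformly. *)
pose o (i : nat) : 'I_4 := inord i.
have := nbr15_avoid4.
move=> /allP/(_ _ (lt8 (o 0)))/allP/(_ _ (lt8 (o 1))).
move=> /allP/(_ _ (lt8 (o 2)))/allP/(_ _ (lt8 (o 3))).
have -> : [:: val (r (o 0)); val (r (o 1)); val (r (o 2)); val (r (o 3))]
    = [seq val (r (o i)) | i <- iota 0 4] by [].
rewrite map_inj_in_uniq ?iota_uniq; last first.
  move=> i j; rewrite !mem_iota /= => i4 j4 /val_inj/rI/(congr1 val).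
  by rewrite /= !inordK.
rewrite leqNgt => /negP; apply.
(* The four columns of the copy all miss the four chosen rows, so the count bounded by 3 would be at
   least 4. *)
apply: (@leq_trans (size [seq val (c j) | j <- enum 'I_4])).
  by rewrite size_map size_enum_ord.
rewrite -size_filter; apply: uniq_leq_size.
  by rewrite map_inj_uniq ?enum_uniq // => i j /val_inj/cI.
move=> _ /mapP[j _ ->]; rewrite mem_filter mem_iota.
rewrite add0n (leq_trans (ltn_ord _)) ?andbT //.
by apply/hasPn=> _ /mapP[i _ ->]; have := rc (o i) j.
Qed.

Theorem theorem6 : is_BR 8 (Kmn 2 2) (Kmn 4 4) 16.
Proof.
split=> //; [exact: Kmn_bipartite|exact: Kmn_bipartite|exact: BR_arrows_8_16|].
move=> n _ arr; rewrite leqNgt; apply/negP=> n15.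
case: (arr (graph15 n)) => [|/(graph15_K22_free n15)//|/(graph15_K44_free n15)//].
by move=> [i|i] [j|j].
Qed.
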